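(* Consider the heterogeneous bump regression (HBR) model with $|I_n|\searrow 0$ and the testing problem $H_0$ against $H_1^n$. Let $\varepsilon_n>0$ be any sequence such that $\varepsilon_n\sqrt{-\log(|I_n|)}\to\infty$ as $n\to\infty$, and let $\alpha\in(0,1)$ be a given significance level. Furthermore let $\sigma_n^2=c\,\sigma_0\Delta_n(1+o(\varepsilon_n))$ with a constant $c>0$, and $\sigma_n^2=o(\varepsilon_n)$ as $n\to\infty$, and $$\sqrt{n|I_n|}\,\Delta_n\succsim(C+\varepsilon_n)\sqrt{-\log(|I_n|)},\qquad C:=\sqrt2\,\sigma_0\sqrt{\frac{2}{2+c^2}}.$$ Then the likelihood ratio test $\Phi_n$, which rejects $H_0$ if and only if $T_n(Y)>c^*_{\alpha,n}$, satisfies $$\limsup_{n\to\infty}\bar\alpha(\Phi_n)\le\alpha\qquad\text{and}\qquad\limsup_{n\to\infty}\bar\beta(\Phi_n)\le\alpha.$$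
   Context: HBR model: for each $n$ one observes $Y=(Y_1,\dots,Y_n)$ with $Y_i=\mu_n(i/n)+\lambda_n(i/n)Z_i$, where $Z_1,\dots,Z_n$ are i.i.d. $\mathcal N(0,1)$. The parameters $\sigma_0>0$ (fixed), $\Delta_n>0$, $\sigma_n>0$ and $|I_n|\in(0,1]$ are known; put $\kappa_n=\sigma_n/\sigma_0$. It is assumed that $l_n:=1/|I_n|\in\mathbb N$ and $n|I_n|\in\mathbb N$, and $\mathcal A_n:=\{((j-1)|I_n|,\,j|I_n|] : 1\le j\le l_n\}$, so that each interval in $\mathcal A_n$ contains exactly $n|I_n|$ of the points $i/n$. The null hypothesis is $H_0:\ \mu_n\equiv 0,\ \lambda_n\equiv\sigma_0$; the alternative is $H_1^n:$ there is $I_n\in\mathcal A_n$ with $\mu_n=\Delta_n 1_{I_n}$ and $\lambda_n^2=\sigma_0^2+\sigma_n^2 1_{I_n}$ (the position of $I_n$ is unknown). For a test $\Phi_n:\mathbb R^n\to\{0,1\}$ (1 means reject $H_0$), the type I error is $\bar\alpha(\Phi_n)=\mathbb P_{H_0}(\Phi_n(Y)=1)$ and the type II error is $\bar\beta(\Phi_n)=\sup_{I_n\in\mathcal A_n}\mathbb P_{\mu_n=\Delta_n1_{I_n},\,\lambda_n^2=\sigma_0^2+\sigma_n^21_{I_n}}(\Phi_n(Y)=0)$. Test statistic: $$T_n(Y):=\sup_{I\in\mathcal A_n}\frac1{\sigma_0^2}\sum_{i:\,i/n\in I}\left(Y_i+\frac{\Delta_n}{\kappa_n^2}\right)^2.$$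 Threshold: $$c^*_{\alpha,n}=n|I_n|+\frac{n|I_n|\Delta_n^2}{\sigma_0^2\kappa_n^4}-2\log(\alpha|I_n|)+2\sqrt{n|I_n|\left(1+2\frac{\Delta_n^2}{\sigma_0^2\kappa_n^4}\right)\log\left(\frac1{\alpha|I_n|}\right)}.$$ Notation: $a_n\succsim b_n$ means there is $N\in\mathbb N$ such that $a_n\ge b_n$ for all $n\ge N$. *)

(* Defs.v *)
From HB Require Import structures.
From mathcomp Require Import all_boot all_order all_algebra.
From mathcomp Require Import all_classical all_reals all_analysis.

Set Implicit Arguments.
Unset Strict Implicit.
Unset Printing Implicit Defensive.
Import Order.TTheory GRing.Theory Num.Theory.
Import numFieldNormedType.Exports.

Local Open Scope classical_set_scope.
Local Open Scope ring_scope.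

Definition mutually_independent (d : measure_display) (T : measurableType d)
    (R : realType) (P : probability T R) (J : finType)
    (X : J -> {RV P >-> R}) : Prop :=
  forall (K : {set J}) (B : J -> set R), (forall j, measurable (B j)) ->
    P (\bigcap_(j in [set` K]) (X j @^-1` B j)) =
    (\prod_(j in K) P (X j @^-1` B j))%E.

Definition iid_standard_normal (d : measure_display) (T : measurableType d)
    (R : realType) (P : probability T R) (n : nat)
    (Z : 'I_n -> {RV P >-> R}) : Prop :=
  mutually_independent Z /\
  forall (i : 'I_n) (B : set R), measurable B ->
    distribution P (Z i) B = normal_prob 0 1 B.

(* Indices are shifted: i : 'I_n stands for the (i+1)-st observation. *)
Definition design (R : realType) (n : nat) (i : 'I_n) : R :=
  i.+1%:R / n%:R.

Definition hbr_obs (R : realType) (mu lambda : R -> R) (n : nat)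
    (z : 'I_n -> R) : 'I_n -> R :=
  fun i => mu (design R i) + lambda (design R i) * z i.

(* The family A_n for interval length len: j ranges over 1, ..., 1 / len. *)
Definition bump_intervals (R : realType) (len : R) : set (set R) :=
  [set I | exists j : nat, [/\ (1 <= j)%N, j%:R <= len^-1 &
     I = `](j%:R - 1) * len, j%:R * len]%classic]].

Definition null_mean (R : realType) : R -> R := fun=> 0.
Definition null_sd (R : realType) (sigma0 : R) : R -> R := fun=> sigma0.

Definition bump_mean (R : realType) (Delta : R) (I : set R) : R -> R :=
  fun x => Delta * \1_I x.
Definition bump_sd (R : realType) (sigma0 sigma : R) (I : set R) : R -> R :=
  fun x => Num.sqrt (sigma0 ^+ 2 + sigma ^+ 2 * \1_I x).

(* A test Phi returns true when it rejects the null hypothesis. *)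
Definition type1_error (d : measure_display) (T : measurableType d)
    (R : realType) (P : probability T R) (n : nat) (Z : 'I_n -> {RV P >-> R})
    (sigma0 : R) (Phi : ('I_n -> R) -> bool) : \bar R :=
  P [set w | Phi (hbr_obs (@null_mean R) (null_sd sigma0)
                    (fun i => Z i w)) = true].

Definition type2_error (d : measure_display) (T : measurableType d)
    (R : realType) (P : probability T R) (n : nat) (Z : 'I_n -> {RV P >-> R})
    (sigma0 Delta sigma len : R) (Phi : ('I_n -> R) -> bool) : \bar R :=
  ereal_sup [set P [set w | Phi (hbr_obs (bump_mean Delta I)
                                   (bump_sd sigma0 sigma I)
                                   (fun i => Z i w)) = false]
            | I in bump_intervals len].

Definition lr_statistic (R : realType) (sigma0 Delta sigma len : R) (n : nat)
    (y : 'I_n -> R) : R :=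
  let kappa := sigma / sigma0 in
  sup [set (sigma0 ^+ 2)^-1 *
           \sum_(i < n | design R i \in I) (y i + Delta / kappa ^+ 2) ^+ 2
      | I in bump_intervals len].

Definition lr_threshold (R : realType) (alpha sigma0 Delta sigma len : R)
    (n : nat) : R :=
  let kappa := sigma / sigma0 in
  n%:R * len + n%:R * len * Delta ^+ 2 / (sigma0 ^+ 2 * kappa ^+ 4)
  - 2 * ln (alpha * len)
  + 2 * Num.sqrt (n%:R * len
                  * (1 + 2 * (Delta ^+ 2 / (sigma0 ^+ 2 * kappa ^+ 4)))
                  * ln (1 / (alpha * len))).

Definition lr_test (R : realType) (alpha sigma0 Delta sigma len : R) (n : nat)
    (y : 'I_n -> R) : bool :=
  lr_threshold alpha sigma0 Delta sigma len n
    < lr_statistic sigma0 Delta sigma len y.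

(* Main.v *)
Require Import Defs.
From HB Require Import structures.
From mathcomp Require Import all_boot all_order all_algebra.
From mathcomp Require Import all_classical all_reals all_analysis.
From mathcomp Require Import measurable_realfun measurable_fun_approximation.
From mathcomp Require Import simple_functions ring lra.
Set Implicit Arguments.
Unset Strict Implicit.
Import Order.TTheory GRing.Theory Num.Theory.
Import numFieldNormedType.Exports.
Local Open Scope classical_set_scope.
Local Open Scope ring_scope.

(** Divided by sigma0^2, the sum of squares over a block of m = n |I_n|
    observations is, under the null hypothesis, a noncentral chi-square
    variable S with m degrees of freedom and noncentrality m a^2, where
    a = Delta / (sigma0 kappa^2).  Over the block that carries the bump it is
    (1 + kappa^2) times such a variable, with a^2 (1 + kappa^2) in place of
    a^2.  Completing the square in the Gaussian density and multiplying over
    independent coordinates gives, for 2 t < 1,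
      E exp (t S) = ((1 - 2t)^(-1/2) exp (t a^2 / (1 - 2t)))^m,
    and Chernoff bounds follow on both sides ([noncentral_upper_tail],
    [noncentral_lower_tail]).

    The threshold is exactly the upper bound m + m a^2 + 2x + 2 sqrt (v x),
    v = m (1 + 2 a^2), that S exceeds with probability at most exp (-x), taken
    at x = - ln (alpha |I_n|).  A union bound over the 1 / |I_n| blocks then
    gives type I error at most alpha for every sample size
    ([type1_error_le]).

    For the type II error it suffices that the threshold lies below the lower
    alpha-tail bound of the statistic of the bump block alone
    ([type2_error_le]).  Write s = sqrt m Delta / sigma0 and
    B = sqrt (2 + a^-2).  The mean of the bump block minus the null mean is
    sqrt v s B + s^2, while the threshold exceeds the null mean by
    2x + 2 sqrt (v x); so everything rests on the gap s B - 2 sqrt x.  Since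
    a^-1 = c (1 + delta), B is close to sqrt (2 + c^2), and the detection
    boundary sqrt (n |I_n|) Delta = C sqrt (- ln |I_n|) is the point where
    s B = 2 sqrt (- ln |I_n|).  The excess eps over C makes the gap at least of
    order eps sqrt (- ln |I_n|), which tends to infinity
    ([detection_gap]).  This beats the three remaining terms: the cost of alpha
    in x, the fluctuation of the bump block, and the term 2x; for the last two
    kappa^2 = o (eps) is what makes the difference ([power_inequality]).  Every
    smallness condition is relative to eps, so eps may tend to infinity. *)

(** * Expectation of a product of independent variables *)

Section Independence.
Local Open Scope ereal_scope.
Import HBNNSimple.

(** The image under [X] of the measure with density [G] is determined by its
    values on sets, hence so are its integrals: by monotone approximation with
    simple functions.  With [X] the identity this integrates against a measure
    given by a density; with a general [X] it integrates a function of [X]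
    times a weight. *)
Lemma ge0_integral_density (d d' : measure_display) (T : measurableType d)
    (Y : measurableType d') (R : realType) (mu : {measure set T -> \bar R})
    (nu : {measure set Y -> \bar R}) (X : T -> Y) (G : T -> R)
    (f : Y -> \bar R) :
  measurable_fun [set: T] X ->
  measurable_fun [set: T] G -> (forall w, (0 <= G w)%R) ->
  (forall B, measurable B -> \int[mu]_(w in X @^-1` B) (G w)%:E = nu B) ->
  measurable_fun [set: Y] f -> (forall y, 0 <= f y) ->
  \int[mu]_w (f (X w) * (G w)%:E) = \int[nu]_y f y.
Proof.
move=> mX mG G0 hB mf f0; pose h := nnsfun_approx measurableT mf.
have hf y : (EFin \o h n) y @[n --> \oo] --> f y.
  by apply: cvg_nnsfun_approx.
have ndh y : nondecreasing_seq (fun n => h n y).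
  by move=> a b ab; exact/lefP/nd_nnsfun_approx.
have -> : \int[mu]_w (f (X w) * (G w)%:E) =
    limn (fun n => \int[mu]_w ((h n (X w))%:E * (G w)%:E)).
  rewrite -monotone_convergence//.
  - apply: eq_integral => w _; apply/esym/cvg_lim => //.
    by apply: cvgeZr => //; exact: hf.
  - move=> n; apply: emeasurable_funM => //; apply/measurable_EFinP => //.
    exact: measurableT_comp.
  - by move=> n w _; rewrite -EFinM lee_fin mulr_ge0.
  - by move=> w _ a b ab; rewrite -!EFinM lee_fin ler_wpM2r//; exact: ndh.
have -> : \int[nu]_y f y = limn (fun n => \int[nu]_y (h n y)%:E).
  rewrite -monotone_convergence//.
  - by apply: eq_integral => y _; apply/esym/cvg_lim => //; exact: hf.
  - by move=> n; exact/measurable_EFinP.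
  - by move=> n y _; rewrite lee_fin.
  - by move=> y _ a b ab; rewrite lee_fin; exact: ndh.
congr (limn _); apply/funext => n.
have ind_ge0 y x : 0 <= (y * \1_(h n @^-1` [set y]) x)%:E.
  exact: nnfun_muleindic_ge0.
have mind y : measurable_fun setT (fun x => (y * \1_(h n @^-1` [set y]) x)%:E).
  by apply/measurable_EFinP; apply: measurable_funM.
have mindX y :
    measurable_fun setT (fun w => (y * \1_(h n @^-1` [set y]) (X w))%:E).
  exact: (measurableT_comp (mind y)).
under eq_integral => w _.
  rewrite fimfunE -fsumEFin// ge0_mule_fsuml//; over.
under [in RHS]eq_integral => y _ do rewrite fimfunE -fsumEFin//.
rewrite !ge0_integral_fsum//; last 2 first.
- by move=> y; apply: emeasurable_funM => //; exact/measurable_EFinP.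
- by move=> y w _; rewrite mule_ge0// lee_fin.
apply: eq_fsbigr => y; rewrite inE => -[y0 _ yE].
have y_ge0 : (0 <= y)%R by rewrite -yE.
under eq_integral do rewrite EFinM -muleA.
under [in RHS]eq_integral do rewrite EFinM.
have mi : measurable (h n @^-1` [set y]) by [].
have mI : measurable_fun setT (fun x => (\1_(h n @^-1` [set y]) x : R)%:E).
  by apply/measurable_EFinP; apply: measurable_indic.
rewrite !ge0_integralZl//; last 2 first.
- apply: emeasurable_funM => //; last exact/measurable_EFinP.
  exact: (measurableT_comp mI).
- by move=> w _; rewrite mule_ge0 ?lee_fin.
congr (_ * _); rewrite integral_indic// setIT -hB// [RHS]integral_mkcond.
apply: eq_integral => w _.
rewrite /patch indicE -[w \in _]/(X w \in _ @^-1` [set y]).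
by case: (X w \in _); rewrite ?mul1e ?mul0e.
Qed.

(** Independence is the case where every factor is an indicator.  The
    indicators are replaced by arbitrary functions one coordinate at a time,
    along [s]: when coordinate [j] is still an indicator, the formula says that
    the image under [X j] of the measure weighted by the other factors is a
    multiple of the law of [X j], so [ge0_integral_density] applies. *)
Lemma expectation_prod_of_indicators (d : measure_display)
    (T : measurableType d) (R : realType) (P : probability T R) (J : finType)
    (X : J -> {RV P >-> R}) (s : seq J) (g : J -> R -> R) (c : J -> R) :
  mutually_independent X ->
  (forall j, j \notin s -> exists2 B, measurable B & g j = \1_B) ->
  (forall j, measurable_fun [set: R] (g j)) -> (forall j x, (0 <= g j x)%R) ->
  (forall j, \int[P]_w (g j (X j w))%:E = (c j)%:E) ->
  \int[P]_w (\prod_j g j (X j w))%R%:E = (\prod_j c j)%R%:E.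
Proof.
move=> indX.
have mX j : measurable_fun [set: T] (X j) by exact: measurable_funP.
have mXB j B : measurable B -> measurable (X j @^-1` B).
  by move=> mB; rewrite -[_ @^-1` _]setTI; exact: mX.
have int_ind j B : measurable B ->
    \int[P]_w (\1_B (X j w) : R)%:E = P (X j @^-1` B).
  move=> mB; rewrite -[in RHS](setIT (X j @^-1` B)) -integral_indic//.
  exact: mXB.
elim: s g c => [|j s IH] g c gs mg g0 gc.
  have /choice[B gB] j : exists B, measurable B /\ g j = \1_B.
    by have [//|B mB gB] := gs j; exists B.
  transitivity (P (\bigcap_(j in [set` [set: J]%SET]) (X j @^-1` B j))).
    rewrite -[in RHS](setIT (\bigcap_(_ in _) _)) -integral_indic//; last first.
      by apply: fin_bigcap_measurable => // j _; apply: mXB; case: (gB j).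
    apply: eq_integral => w _; congr EFin; rewrite indicE.
    have [wB|wB] := boolP (w \in _).
      rewrite big1// => j _; rewrite (gB j).2 indicE.
      by move: wB; rewrite inE => /(_ j) wB; rewrite mem_set//; apply: wB => /=.
    have [j wj] : exists j, ~ B j (X j w).
      apply/existsNP => wBall; move/negP: wB; apply; rewrite inE => j _.
      exact: wBall.
    by rewrite (bigD1 j)//= (gB j).2 indicE memNset// mul0r.
  rewrite indX; last by move=> j; case: (gB j).
  rewrite -prodEFin; apply: eq_big => [j|j _]; first by rewrite inE.
  by rewrite -gc (gB j).2 int_ind//; case: (gB j).
have c0 i : (0 <= c i)%R.
  by rewrite -lee_fin -gc; apply: integral_ge0 => w _; rewrite lee_fin.
have mgX i : measurable_fun [set: T] (fun w => g i (X i w)).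
  exact: (measurableT_comp (mg i)).
under eq_integral do rewrite (bigD1 j)//= EFinM.
have c'0 : (0 <= \prod_(i | i != j) c i)%R by exact: prodr_ge0.
rewrite (@ge0_integral_density _ _ _ _ _ _
  (mscale (NngNum c'0) (distribution P (X j))) (X j)
  (fun w => \prod_(i | i != j) g i (X i w))%R (EFin \o g j)) /=.
- rewrite ge0_integral_mscale//=; first last.
  + by move=> y _; rewrite lee_fin.
  + exact/measurable_EFinP.
  rewrite ge0_integral_distribution//; first last.
  + by move=> y; rewrite lee_fin.
  + exact/measurable_EFinP.
  by rewrite gc -EFinM mulrC [in RHS](bigD1 j).
- exact: mX.
- rewrite (_ : (fun _ => _) =
    (fun w => \prod_(i <- [seq i <- index_enum J | i != j]) g i (X i w))%R).
    by apply: measurable_prod => i _.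
  by apply/funext => w; rewrite big_filter.
- by move=> w; apply: prodr_ge0.
- move=> B mB.
  pose g' i := if i == j then \1_B : R -> R else g i.
  pose c' i := if i == j then fine (P (X j @^-1` B)) else c i.
  have PB : P (X j @^-1` B) = (fine (P (X j @^-1` B)))%:E.
    by rewrite fineK// fin_num_measure//; exact: mXB.
  have g'E w : (\prod_i g' i (X i w))%R =
      (\1_B (X j w) * \prod_(i | i != j) g i (X i w))%R.
    rewrite (bigD1 j)//= {1}/g' eqxx; congr (_ * _)%R.
    by apply: eq_bigr => i /negbTE ij; rewrite /g' ij.
  have c'E : (\prod_i c' i)%R =
      (fine (P (X j @^-1` B)) * \prod_(i | i != j) c i)%R.
    rewrite (bigD1 j)//= {1}/c' eqxx; congr (_ * _)%R.
    by apply: eq_bigr => i /negbTE ij; rewrite /c' ij.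
  rewrite /mscale/= [distribution _ _ _]PB muleC -EFinM -c'E -(IH g').
  + rewrite integral_mkcond; apply: eq_integral => w _.
    rewrite g'E /patch indicE -[w \in _]/(X j w \in B).
    by case: (X j w \in B); rewrite ?mul1r ?mul0r.
  + move=> i; rewrite /g'; have [->|ij is_] := eqVneq i j; first by exists B.
    by apply: gs; rewrite inE negb_or ij.
  + by move=> i; rewrite /g'; case: ifP.
  + by move=> i x; rewrite /g'; case: ifP.
  + move=> i; rewrite /g' /c'; have [->|ij] := eqVneq i j; last exact: gc.
    by rewrite int_ind.
- exact/measurable_EFinP.
- by move=> x; rewrite lee_fin.
Qed.

Lemma expectation_prod (d : measure_display) (T : measurableType d)
    (R : realType) (P : probability T R) (J : finType)
    (X : J -> {RV P >-> R}) (g : J -> R -> R) (c : J -> R) :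
  mutually_independent X ->
  (forall j, measurable_fun [set: R] (g j)) -> (forall j x, (0 <= g j x)%R) ->
  (forall j, \int[P]_w (g j (X j w))%:E = (c j)%:E) ->
  \int[P]_w (\prod_j g j (X j w))%R%:E = (\prod_j c j)%R%:E.
Proof.
move=> indX.
apply: (expectation_prod_of_indicators (s := index_enum J)) => // j.
by rewrite mem_index_enum.
Qed.

End Independence.

(** * Exponential moment of a shifted squared normal variable *)

(** With [y] = exp r this is r <= sinh r, which holds because the derivative
    exp r + exp (- r) - 2 is a square. *)
Lemma ln_le_half_sub_inv (R : realType) (y : R) :
  1 <= y -> ln y <= (y - y^-1) / 2.
Proof.
move=> y1; have y0 : 0 < y by apply: lt_le_trans y1.
pose f r : R := expR r - expR (- r) - 2 * r.
have df (r : R) : is_derive r (1 : R) f (expR r + expR (- r) - 2).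
  apply: is_derive_eq; rewrite /GRing.scale/=; ring.
have r0 : 0 <= ln y by rewrite ln_ge0.
have : f 0 <= f (ln y).
  apply: (@ger0_derive1_le_cc _ f 0 (ln y)) => //.
  - move=> x _; rewrite derive1E derive_val.
    have -> : expR x + expR (- x) - 2 = (expR (x / 2) - expR (- (x / 2))) ^+ 2.
      have -> : expR x = expR (x / 2) ^+ 2.
        by rewrite -expRM_natl mulrC divfK.
      have -> : expR (- x) = expR (- (x / 2)) ^+ 2.
        by rewrite -expRM_natl mulrN mulrC divfK.
      have : expR (x / 2) * expR (- (x / 2)) = 1 by rewrite -expRD subrr expR0.
      nra.
    exact: sqr_ge0.
  - apply: continuous_subspaceT => x.
    by apply/differentiable_continuous/derivable1_diffP.
  - by rewrite in_itv/= lexx.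
  - by rewrite in_itv/= lexx r0.
rewrite /f oppr0 subrr mulr0 subrr expRN lnK ?posrE//; lra.
Qed.

(** Completing the square turns the integrand times the standard normal density
    into a constant times a normal density of variance 1 / (1 - 2t).  The
    measure is abstract because the law of a random variable and [normal_prob]
    live on differently presented Borel structures of the line. *)
Lemma integral_standard_normal_exp_sq (R : realType)
    (nu : {measure set R -> \bar R}) (a t : R) :
  (forall B, measurable B -> nu B = normal_prob 0 1 B) -> 2 * t < 1 ->
  (\int[nu]_x (expR (t * (x + a) ^+ 2))%:E =
   ((Num.sqrt (1 - 2 * t))^-1 * expR (t * a ^+ 2 / (1 - 2 * t)))%:E)%E.
Proof.
move=> nuE t_lt; have u0 : 0 < 1 - 2 * t by lra.
set s := Num.sqrt (1 - 2 * t).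
have s0 : 0 < s by rewrite sqrtr_gt0.
have s2 : s ^+ 2 = 1 - 2 * t by rewrite sqr_sqrtr// ltW.
have mf : measurable_fun [set: R] (fun x => (expR (t * (x + a) ^+ 2))%:E).
  apply/measurable_EFinP; apply: measurableT_comp => //.
  apply: measurable_funM => //; apply: measurable_funX.
  by apply: measurable_funD.
rewrite -(@ge0_integral_density _ _ _ _ _ lebesgue_measure nu id
  (normal_pdf 0 1))//; last 3 first.
- exact: measurable_normal_pdf.
- by move=> x; exact: normal_pdf_ge0.
- by move=> B mB; rewrite nuE.
pose m := 2 * t * a / (1 - 2 * t).
transitivity (\int[lebesgue_measure]_x
   ((s^-1 * expR (t * a ^+ 2 / (1 - 2 * t)))%:E * (normal_pdf m s^-1 x)%:E))%E.
  apply: eq_integral => x _; rewrite -!EFinM; congr EFin.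
  rewrite !normal_pdfE ?oner_eq0 ?invr_eq0 ?gt_eqF// /normal_peak /normal_fun.
  rewrite subr0 expr1n mul1r.
  have -> : Num.sqrt (s^-1 ^+ 2 * pi *+ 2) = s^-1 * Num.sqrt (pi *+ 2).
    by rewrite -mulrnAr sqrtrM ?sqr_ge0// sqrtr_sqr ger0_norm// invr_ge0 ltW.
  rewrite invfM invrK.
  move: (Num.sqrt (pi *+ 2)) => q.
  rewrite mulrCA -expRD.
  transitivity (q^-1 *
    (expR (t * a ^+ 2 / (1 - 2 * t)) *
     expR (- (x - m) ^+ 2 / (s^-1 ^+ 2 *+ 2)))).
    rewrite -expRD; congr (_ * expR _).
    by rewrite exprVn s2 /m; field; lra.
  set E1 := expR (_ / _); set E2 := expR _; set r := q^-1.
  by field; exact: lt0r_neq0.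
rewrite ge0_integralZl//.
- by rewrite integral_normal_pdf mule1.
- by apply/measurable_EFinP; exact: measurable_normal_pdf.
- by move=> x _; rewrite lee_fin normal_pdf_ge0.
- by rewrite lee_fin mulr_ge0 ?expR_ge0// invr_ge0 ltW.
Qed.

(** After taking logarithms the term in a^2 is exact, and the square root
    contributes - ln (1 - 2t) / 2 <= t + t^2 / (1 - 2t).  This is
    [ln_le_half_sub_inv] at y = 1 / (1 - 2t), where the right-hand side is
    (y - 1/y) / 4. *)
Lemma exp_sq_moment_le_upper (R : realType) (a t : R) :
  2 * t < 1 -> 0 <= t ->
  (Num.sqrt (1 - 2 * t))^-1 * expR (t * a ^+ 2 / (1 - 2 * t)) <=
  expR (t * (1 + a ^+ 2) + t ^+ 2 / (1 - 2 * t) * (1 + 2 * a ^+ 2)).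
Proof.
move=> t_lt t0; have u0 : 0 < 1 - 2 * t by lra.
have s0 : 0 < Num.sqrt (1 - 2 * t) by rewrite sqrtr_gt0.
rewrite -{1}[(Num.sqrt _)^-1]lnK ?posrE ?invr_gt0// -expRD ler_expR.
have y1 : 1 <= (1 - 2 * t)^-1 by rewrite invf_ge1//; lra.
have := ln_le_half_sub_inv y1.
rewrite -{1}[1 - 2 * t]sqr_sqrtr; last exact: ltW.
rewrite -exprVn lnXn ?invr_gt0// invrK => h.
have -> : t * (1 + a ^+ 2) + t ^+ 2 / (1 - 2 * t) * (1 + 2 * a ^+ 2) =
  ((1 - 2 * t)^-1 - (1 - 2 * t)) / 4 + t * a ^+ 2 / (1 - 2 * t).
  by field; lra.
rewrite lerD2r; lra.
Qed.

(** The crude ln y <= y - 1 suffices here: the type II error leaves room for a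
    worse constant in the lower tail. *)
Lemma exp_sq_moment_le_lower (R : realType) (a t : R) : t <= 0 ->
  (Num.sqrt (1 - 2 * t))^-1 * expR (t * a ^+ 2 / (1 - 2 * t)) <=
  expR (t * (1 + a ^+ 2) + 2 * t ^+ 2 * (1 + 2 * a ^+ 2)).
Proof.
move=> t0; have u0 : 0 < 1 - 2 * t by lra.
have s0 : 0 < Num.sqrt (1 - 2 * t) by rewrite sqrtr_gt0.
rewrite -{1}[(Num.sqrt _)^-1]lnK ?posrE ?invr_gt0// -expRD ler_expR.
have : ln ((1 - 2 * t)^-1) <= (1 - 2 * t)^-1 - 1.
  have := @le_ln1Dx R ((1 - 2 * t)^-1 - 1); rewrite addrCA subrr addr0; apply.
  by rewrite ltrBrDl subrr invr_gt0.
rewrite -{1}[1 - 2 * t]sqr_sqrtr; last exact: ltW.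
rewrite -exprVn lnXn ?invr_gt0// => h.
have w1 : (1 - 2 * t)^-1 <= 1 by rewrite invf_le1//; lra.
have -> : t * a ^+ 2 / (1 - 2 * t) =
  t * a ^+ 2 + 2 * t ^+ 2 * a ^+ 2 * (1 - 2 * t)^-1 by field; lra.
have w_exp : (1 - 2 * t)^-1 = 1 + 2 * t + 4 * (t ^+ 2 * (1 - 2 * t)^-1).
  by field; lra.
have ta0 : 0 <= t ^+ 2 * a ^+ 2 by rewrite mulr_ge0 ?sqr_ge0.
have ta1 : t ^+ 2 * a ^+ 2 * (1 - 2 * t)^-1 <= t ^+ 2 * a ^+ 2.
  by rewrite ler_piMr.
have tw1 : t ^+ 2 * (1 - 2 * t)^-1 <= t ^+ 2 by rewrite ler_piMr// sqr_ge0.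
move: h w_exp ta1 tw1.
by move: (1 - 2 * t)^-1 (ln _) => w l h w_exp ta1 tw1; lra.
Qed.

(** * Tails of the noncentral chi-square distribution *)

Lemma measurable_superlevel (d : measure_display) (T : measurableType d)
    (R : realType) (f : T -> R) (u : R) :
  measurable_fun [set: T] f -> measurable [set w | u < f w].
Proof.
move=> mf; rewrite -[X in measurable X]setTI.
have -> : [set w | u < f w] = f @^-1` `]u, +oo[%classic.
  by apply/seteqP; split=> w /=; rewrite in_itv/= andbT.
by apply: mf => //; exact: measurable_itv.
Qed.

Lemma measurable_weak_superlevel (d : measure_display) (T : measurableType d)
    (R : realType) (f : T -> R) (u : R) :
  measurable_fun [set: T] f -> measurable [set w | u <= f w].
Proof.
move=> mf; rewrite -[X in measurable X]setTI.
have -> : [set w | u <= f w] = f @^-1` `[u, +oo[%classic.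
  by apply/seteqP; split=> w /=; rewrite in_itv/= andbT.
by apply: mf => //; exact: measurable_itv.
Qed.

Section NoncentralChiSquare.
Context (d : measure_display) (T : measurableType d) (R : realType).
Context (P : probability T R) (n : nat) (Z : 'I_n -> {RV P >-> R}).
Hypothesis iidZ : iid_standard_normal Z.
Implicit Types (K : {set 'I_n}) (a t x : R).

Lemma integral_exp_sq_shifted_normal (i : 'I_n) a t : 2 * t < 1 ->
  (\int[P]_w (expR (t * (Z i w + a) ^+ 2))%:E =
   ((Num.sqrt (1 - 2 * t))^-1 * expR (t * a ^+ 2 / (1 - 2 * t)))%:E)%E.
Proof.
move=> t_lt.
rewrite -(integral_standard_normal_exp_sq (nu := distribution P (Z i)))//.
  rewrite ge0_integral_distribution//.
  apply/measurable_EFinP; apply: measurableT_comp => //.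
  apply: measurable_funM => //; apply: measurable_funX.
  exact: measurable_funD.
exact: iidZ.2.
Qed.

Lemma measurable_sum_sq K a :
  measurable_fun [set: T] (fun w => \sum_(i in K) (Z i w + a) ^+ 2).
Proof.
under eq_fun do rewrite -big_filter.
apply: measurable_sum => i; apply: measurable_funX.
exact: measurable_funD.
Qed.

Lemma integral_exp_sum_sq K a t : 2 * t < 1 ->
  (\int[P]_w (expR (t * \sum_(i in K) (Z i w + a) ^+ 2))%:E =
   (((Num.sqrt (1 - 2 * t))^-1 * expR (t * a ^+ 2 / (1 - 2 * t)))
      ^+ #|K|)%:E)%E.
Proof.
move=> t_lt; set q := _ * _.
pose g i x := if i \in K then expR (t * (x + a) ^+ 2) else 1.
pose c i := if i \in K then q else 1.
transitivity (\int[P]_w (\prod_i g i (Z i w))%:E)%E.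
  apply: eq_integral => w _; congr EFin.
  by rewrite mulr_sumr expR_sum /g big_mkcond.
rewrite (expectation_prod (c := c) iidZ.1).
- by rewrite /c -big_mkcond prodr_const.
- move=> i; rewrite /g; case: (i \in K) => //; apply: measurableT_comp => //.
  apply: measurable_funM => //; apply: measurable_funX.
  exact: measurable_funD.
- by move=> i x; rewrite /g; case: ifP => // _; exact: expR_ge0.
- move=> i; rewrite /g /c; case: ifP => _.
    exact: integral_exp_sq_shifted_normal.
  by rewrite integral_cst//= probability_setT mule1.
Qed.

Lemma chernoff_sum_sq K a t u : 2 * t < 1 ->
  (P [set w | (u <= t * \sum_(i in K) (Z i w + a) ^+ 2)%R] <=
   (((Num.sqrt (1 - 2 * t))^-1 * expR (t * a ^+ 2 / (1 - 2 * t))) ^+ #|K|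
     * expR (- u))%:E)%E.
Proof.
move=> t_lt; pose f w := t * \sum_(i in K) (Z i w + a) ^+ 2.
have mf : measurable_fun [set: T] f.
  by apply: measurable_funM => //; exact: measurable_sum_sq.
pose X : {mfun T >-> R} := HB.pack f (isMeasurableFun.Build _ _ _ _ f mf).
have := @chernoff _ _ _ P X 1 u ltr01.
rewrite /mmt_gen_fun unlock mul1r EFinM -integral_exp_sum_sq//.
by under eq_integral do rewrite /= mulr1.
Qed.

(** With s = sqrt v and r = sqrt x the Chernoff exponent is optimal at
    t = r / (s + 2r), where it equals - x exactly. *)
Lemma noncentral_upper_tail K a x : (0 < #|K|)%N -> 0 < x ->
  (P [set w | (#|K|%:R * (1 + a ^+ 2) + 2 * x
              + 2 * Num.sqrt (#|K|%:R * (1 + 2 * a ^+ 2) * x)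
              < \sum_(i in K) (Z i w + a) ^+ 2)%R]
   <= (expR (- x))%:E)%E.
Proof.
move=> K0 x0; set m : R := #|K|%:R; set v := m * (1 + 2 * a ^+ 2).
set thr := _ + _.
have m0 : 0 < m by rewrite ltr0n.
have a0 : 0 < 1 + 2 * a ^+ 2 by have := sqr_ge0 a; lra.
have v0 : 0 < v by rewrite mulr_gt0.
set s := Num.sqrt v; set r := Num.sqrt x.
have s0 : 0 < s by rewrite sqrtr_gt0.
have r0 : 0 < r by rewrite sqrtr_gt0.
have s2 : s ^+ 2 = v by rewrite sqr_sqrtr// ltW.
have r2 : r ^+ 2 = x by rewrite sqr_sqrtr// ltW.
have sr0 : 0 < s + 2 * r by lra.
pose t := r / (s + 2 * r).
have t0 : 0 < t by rewrite divr_gt0.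
have tE : 1 - 2 * t = s / (s + 2 * r) by rewrite /t; field; exact: lt0r_neq0.
have t1 : 2 * t < 1 by rewrite -subr_gt0 tE divr_gt0.
apply: (@le_trans _ _ (P [set w | t * thr <=
    t * \sum_(i in K) (Z i w + a) ^+ 2]%R)).
  apply: le_measure; rewrite ?inE.
  - exact: measurable_superlevel (measurable_sum_sq K a).
  - apply: measurable_weak_superlevel.
    by apply: measurable_funM => //; exact: measurable_sum_sq.
  - by move=> w /= h; rewrite ler_pM2l// ltW.
apply: (le_trans (chernoff_sum_sq _ _ _ t1)); rewrite lee_fin.
have h := exp_sq_moment_le_upper a t1 (ltW t0).
apply: (@le_trans _ _ (expR (t * (1 + a ^+ 2)
    + t ^+ 2 / (1 - 2 * t) * (1 + 2 * a ^+ 2)) ^+ #|K| * expR (- (t * thr)))).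
  by rewrite ler_wpM2r ?expR_ge0// lerXn2r ?nnegrE ?expR_ge0// mulr_ge0
    ?expR_ge0// invr_ge0 sqrtr_ge0.
rewrite -expRM_natl -expRD ler_expR le_eqVlt; apply/orP; left; apply/eqP.
rewrite -/m tE /thr /v -/v sqrtrM; last exact: ltW.
rewrite -/s -/r.
transitivity (t ^+ 2 / (s / (s + 2 * r)) * v - t * (2 * x + 2 * (s * r))).
  by rewrite /v; ring.
rewrite -s2 -r2 /t; field.
by rewrite !lt0r_neq0.
Qed.

(** The exponent 2 t^2 v + t u at u = sqrt (8 v x) is least at
    t = - u / (4 v), where it equals - x. *)
Lemma noncentral_lower_tail K a x : (0 < #|K|)%N -> 0 < x ->
  (P [set w | (\sum_(i in K) (Z i w + a) ^+ 2 <= #|K|%:R * (1 + a ^+ 2)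
              - Num.sqrt (8 * (#|K|%:R * (1 + 2 * a ^+ 2)) * x))%R]
   <= (expR (- x))%:E)%E.
Proof.
move=> K0 x0; set m : R := #|K|%:R; set v := m * (1 + 2 * a ^+ 2).
set thr := _ - _.
have m0 : 0 < m by rewrite ltr0n.
have a0 : 0 < 1 + 2 * a ^+ 2 by have := sqr_ge0 a; lra.
have v0 : 0 < v by rewrite mulr_gt0.
pose u := Num.sqrt (8 * v * x).
have u0 : 0 < u by rewrite sqrtr_gt0 !mulr_gt0.
have u2 : u ^+ 2 = 8 * v * x by rewrite sqr_sqrtr// ltW// !mulr_gt0.
pose t := - (u / (4 * v)).
have t0 : t < 0 by rewrite oppr_lt0 divr_gt0// mulr_gt0.
have t1 : 2 * t < 1 by lra.
rewrite (_ : [set w | _] =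
  [set w | t * thr <= t * \sum_(i in K) (Z i w + a) ^+ 2]); last first.
  by apply/seteqP; split=> w /=; rewrite ler_nM2l.
apply: (le_trans (chernoff_sum_sq _ _ _ t1)); rewrite lee_fin.
have h := exp_sq_moment_le_lower a (ltW t0).
apply: (@le_trans _ _ (expR (t * (1 + a ^+ 2)
    + 2 * t ^+ 2 * (1 + 2 * a ^+ 2)) ^+ #|K| * expR (- (t * thr)))).
  by rewrite ler_wpM2r ?expR_ge0// lerXn2r ?nnegrE ?expR_ge0// mulr_ge0
    ?expR_ge0// invr_ge0 sqrtr_ge0.
rewrite -expRM_natl -expRD ler_expR le_eqVlt; apply/orP; left; apply/eqP.
rewrite -/m /thr -/u.
transitivity (2 * t ^+ 2 * v + t * u); first by rewrite /v; ring.
transitivity (- u ^+ 2 / (8 * v)).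
  by rewrite /t; field; exact: lt0r_neq0.
by rewrite u2; field; exact: lt0r_neq0.
Qed.

End NoncentralChiSquare.

(** * The blocks and the test *)

Definition block (R : realType) (n : nat) (I : set R) : {set 'I_n} :=
  [set i | design R i \in I].

Definition block_statistic (R : realType) (n : nat) (sigma0 Delta sigma : R)
    (y : 'I_n -> R) (I : set R) : R :=
  (sigma0 ^+ 2)^-1 *
  \sum_(i in block n I) (y i + Delta / (sigma / sigma0) ^+ 2) ^+ 2.

Definition bump_interval (R : realType) (len : R) (j : nat) : set R :=
  `]j%:R * len, j.+1%:R * len]%classic.

Section Blocks.
Context (R : realType) (n : nat) (len : R).
Hypotheses (n_gt0 : (0 < n)%N) (len_gt0 : 0 < len).
Hypotheses (len_inv : len^-1 \is a Num.nat) (len_n : n%:R * len \is a Num.nat).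

Let L := Num.truncn len^-1.
Let m := Num.truncn (n%:R * len).

Lemma truncn_len_inv : L%:R = len^-1. Proof. by rewrite truncnK. Qed.

Let mE : m%:R = n%:R * len. Proof. by rewrite truncnK. Qed.

Let n_eq : n = (m * L)%N.
Proof.
apply/eqP; rewrite -(eqr_nat R) natrM mE truncn_len_inv.
by rewrite mulfK// gt_eqF.
Qed.

Let m_gt0 : (0 < m)%N.
Proof. by have := n_gt0; rewrite n_eq muln_gt0 => /andP[]. Qed.

Lemma num_blocks_gt0 : (0 < L)%N.
Proof. by have := n_gt0; rewrite n_eq muln_gt0 => /andP[]. Qed.

Lemma bump_intervalsE : bump_intervals len = bump_interval len @` `I_L.
Proof.
apply/seteqP; split=> [I [j [j1 jL ->]]|_ [j jL <-]].
  have jL' : (j.-1 < L)%N by rewrite prednK// -(ler_nat R) truncn_len_inv.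
  exists j.-1 => //; rewrite /bump_interval /= prednK//.
  by rewrite -subn1 natrB.
exists j.+1; split => //; first by rewrite -truncn_len_inv ler_nat.
by rewrite /bump_interval -natr1 addrK.
Qed.

(** Since n = m L with L = 1 / |I_n| and |I_n| = m / n, the point (i + 1) / n
    lies in the j-th interval (counted from 0) exactly when
    j m <= i < (j + 1) m. *)
Lemma card_block I : bump_intervals len I -> #|block n I|%:R = n%:R * len.
Proof.
rewrite bump_intervalsE -mE => -[j jL <-]; congr (_ %:R).
have jm : (j.+1 * m <= n)%N by rewrite n_eq mulnC leq_mul2l jL orbT.
have lt_n (i : 'I_m) : (j * m + i < n)%N.
  by rewrite (leq_trans _ jm)// mulSn addnC ltn_add2r.
pose f (i : 'I_m) : 'I_n := Ordinal (lt_n i).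
have f_inj : injective f by move=> i i' /(congr1 val)/= /addnI /val_inj.
rewrite -[RHS]card_ord -[RHS](card_imset predT f_inj); apply: eq_card => i.
have nR : 0 < n%:R :> R by rewrite ltr0n.
have -> : (i \in block n (bump_interval len j)) = (j * m <= i < j.+1 * m)%N.
  rewrite inE mem_setE in_itv/= /design ltr_pdivlMr// ler_pdivrMr//.
  by rewrite -!mulrA ![len * _]mulrC -mE -!natrM ltr_nat ler_nat ltnS.
apply/idP/imsetP => [/andP[ji ij]|[i' _ ->]].
  have im : (i - j * m < m)%N by rewrite ltn_subLR// addnC -mulSn.
  by exists (Ordinal im) => //; apply: val_inj; rewrite /= subnKC.
by rewrite /= leq_addr mulSn [(m + _)%N]addnC ltn_add2l ltn_ord.
Qed.

Lemma card_block_gt0 I : bump_intervals len I -> (0 < #|block n I|)%N.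
Proof. by move=> /card_block h; rewrite -(ltr_nat R) h -mE ltr_nat. Qed.

(** The statistic is a [sup] of real numbers, so reading it as a maximum needs
    an upper bound: the sum of squares over all observations. *)
Lemma lr_testP (alpha sigma0 Delta sigma : R) (y : 'I_n -> R) :
  reflect (exists2 j, (j < L)%N & lr_threshold alpha sigma0 Delta sigma len n <
             block_statistic sigma0 Delta sigma y (bump_interval len j))
          (lr_test alpha sigma0 Delta sigma len y).
Proof.
have bE I : (sigma0 ^+ 2)^-1 * \sum_(i < n | design R i \in I)
    (y i + Delta / (sigma / sigma0) ^+ 2) ^+ 2 =
    block_statistic sigma0 Delta sigma y I.
  by congr (_ * _); apply: eq_bigl => i; rewrite inE.
rewrite /lr_test /lr_statistic bump_intervalsE; apply: (iffP idP).
  move=> /sup_gt[|_ [_ [j jL <-] <-]].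
    exists (block_statistic sigma0 Delta sigma y (bump_interval len 0)).
    exists (bump_interval len 0); last exact: bE.
    by exists 0%N => //; exact: num_blocks_gt0.
  by rewrite bE => h; exists j.
move=> [j jL h]; apply: (lt_le_trans h); apply: ub_le_sup; last first.
  by exists (bump_interval len j); [exists j|rewrite bE].
exists ((sigma0 ^+ 2)^-1 *
  \sum_(i < n) (y i + Delta / (sigma / sigma0) ^+ 2) ^+ 2).
move=> _ [I _ <-]; rewrite ler_wpM2l ?invr_ge0 ?sqr_ge0//.
rewrite big_mkcond; apply: ler_sum => i _.
by case: ifP => // _; exact: sqr_ge0.
Qed.

End Blocks.

(** * Error bounds for a fixed sample size *)

Section Errors.
Context (d : measure_display) (T : measurableType d) (R : realType).
Context (P : probability T R) (n : nat) (Z : 'I_n -> {RV P >-> R}).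
Context (sigma0 Delta sigma len alpha : R).
Hypothesis iidZ : iid_standard_normal Z.
Hypotheses (n_gt0 : (0 < n)%N) (len_gt0 : 0 < len) (len_le1 : len <= 1).
Hypotheses (len_inv : len^-1 \is a Num.nat) (len_n : n%:R * len \is a Num.nat).
Hypotheses (sigma0_gt0 : 0 < sigma0) (sigma_gt0 : 0 < sigma).
Hypotheses (alpha_gt0 : 0 < alpha) (alpha_lt1 : alpha < 1).

Let kappa2 := (sigma / sigma0) ^+ 2.
Let a := Delta / (sigma0 * kappa2).
Let m := n%:R * len.
Let test := @lr_test R alpha sigma0 Delta sigma len n.

Let kappa2_gt0 : 0 < kappa2.
Proof. by rewrite exprn_gt0// divr_gt0. Qed.

(** In terms of [a] and [m] the threshold is the bound of
    [noncentral_upper_tail] at x = - ln (alpha |I_n|). *)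
Lemma lr_thresholdE : lr_threshold alpha sigma0 Delta sigma len n =
  m * (1 + a ^+ 2) + 2 * ln (alpha * len)^-1
  + 2 * Num.sqrt (m * (1 + 2 * a ^+ 2) * ln (alpha * len)^-1).
Proof.
have k0 := lt0r_neq0 kappa2_gt0; have s0 := lt0r_neq0 sigma0_gt0.
rewrite /lr_threshold -/m div1r [(sigma / sigma0) ^+ 4](exprM _ 2 2) -/kappa2.
have -> : Delta ^+ 2 / (sigma0 ^+ 2 * kappa2 ^+ 2) = a ^+ 2.
  by rewrite /a; field; rewrite k0.
have -> : m * Delta ^+ 2 / (sigma0 ^+ 2 * kappa2 ^+ 2) = m * a ^+ 2.
  by rewrite /a; field; rewrite k0.
by rewrite lnV ?posrE ?mulr_gt0//; ring.
Qed.

Lemma block_statistic_null (z : 'I_n -> R) I :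
  block_statistic sigma0 Delta sigma
    (hbr_obs (@null_mean R) (null_sd sigma0) z) I =
  \sum_(i in block n I) (z i + a) ^+ 2.
Proof.
have k0 := lt0r_neq0 kappa2_gt0; have s0 := lt0r_neq0 sigma0_gt0.
rewrite /block_statistic mulr_sumr; apply: eq_bigr => i _.
rewrite /hbr_obs /null_mean /null_sd -/kappa2 /a; field.
by rewrite k0.
Qed.

Lemma block_statistic_bump (z : 'I_n -> R) I :
  block_statistic sigma0 Delta sigma
    (hbr_obs (bump_mean Delta I) (bump_sd sigma0 sigma I) z) I =
  (1 + kappa2) *
  \sum_(i in block n I) (z i + a * Num.sqrt (1 + kappa2)) ^+ 2.
Proof.
have k0 := lt0r_neq0 kappa2_gt0; have s0 := lt0r_neq0 sigma0_gt0.
have k1 : 0 < 1 + kappa2 by rewrite addr_gt0.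
rewrite /block_statistic !mulr_sumr; apply: eq_bigr => i; rewrite inE => iI.
rewrite /hbr_obs /bump_mean /bump_sd -/kappa2 indicE iI !mulr1.
have -> : sigma0 ^+ 2 + sigma ^+ 2 = sigma0 ^+ 2 * (1 + kappa2).
  by rewrite /kappa2; field.
rewrite sqrtrM ?sqr_ge0// sqrtr_sqr gtr0_norm//.
have r2 : Num.sqrt (1 + kappa2) ^+ 2 = 1 + kappa2 by rewrite sqr_sqrtr// ltW.
move: r2; set r := Num.sqrt _ => r2.
rewrite -[1 + kappa2]r2.
have kE : kappa2 = r ^+ 2 - 1 by rewrite r2 addrAC subrr add0r.
move: k0; rewrite /a kE => k0; field.
by rewrite k0.
Qed.

Let ln_gt0_alpha : 0 < ln (alpha * len)^-1.
Proof.
rewrite ln_gt0// invf_gt1 ?mulr_gt0//.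
by apply: le_lt_trans alpha_lt1; rewrite ler_piMr// ltW.
Qed.

Lemma measurable_block_statistic_gt (mu lambda : R -> R) (u : R) I :
  measurable [set w | u < block_statistic sigma0 Delta sigma
                            (hbr_obs mu lambda (fun i => Z i w)) I].
Proof.
apply: measurable_superlevel; apply: measurable_funM => //.
under eq_fun do rewrite -big_filter.
apply: measurable_sum => i; apply: measurable_funX.
by do 2 apply: measurable_funD => //; apply: measurable_funM.
Qed.

Lemma rejection_eventE (mu lambda : R -> R) :
  [set w | test (hbr_obs mu lambda (fun i => Z i w)) = true] =
  \big[setU/set0]_(j < Num.truncn len^-1)
    [set w | lr_threshold alpha sigma0 Delta sigma len n <
       block_statistic sigma0 Delta sigma (hbr_obs mu lambda (fun i => Z i w))
         (bump_interval len j)].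
Proof.
rewrite -(bigcup_mkord _ (fun j => [set w | _ < block_statistic sigma0 Delta
  sigma (hbr_obs mu lambda (fun i => Z i w)) (bump_interval len j)])).
apply/seteqP; split=> w /=.
  by move=> /(lr_testP n_gt0 len_gt0 len_inv len_n) [j jL rej]; exists j.
move=> [j jL rej]; apply/(lr_testP n_gt0 len_gt0 len_inv len_n).
by exists j.
Qed.

Lemma measurable_rejection_event (mu lambda : R -> R) :
  measurable [set w | test (hbr_obs mu lambda (fun i => Z i w)) = true].
Proof.
rewrite rejection_eventE; apply: bigsetU_measurable => j _.
exact: measurable_block_statistic_gt.
Qed.

Lemma type1_error_le : (type1_error Z sigma0 test <= alpha%:E)%E.
Proof.
rewrite /type1_error rejection_eventE.
apply: (le_trans (@Boole_inequality _ _ _ P (fun j => [set w |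
  lr_threshold alpha sigma0 Delta sigma len n < block_statistic sigma0 Delta
  sigma (hbr_obs (@null_mean R) (null_sd sigma0) (fun i => Z i w))
  (bump_interval len j)]) _ _)).
  by move=> j _; exact: measurable_block_statistic_gt.
apply: (@le_trans _ _ (\sum_(j < Num.truncn len^-1) (alpha * len)%:E)%E).
  apply: lee_sum => j _.
  have bj : bump_intervals len (bump_interval len j).
    by rewrite bump_intervalsE//; exists j => //=.
  have := noncentral_upper_tail iidZ a
    (card_block_gt0 n_gt0 len_gt0 len_inv len_n bj) ln_gt0_alpha.
  rewrite (card_block n_gt0 len_gt0 len_inv len_n bj) -/m -lr_thresholdE.
  rewrite lnV ?posrE ?mulr_gt0// opprK lnK ?posrE ?mulr_gt0//.
  by under eq_set do rewrite -block_statistic_null.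
rewrite sumEFin lee_fin sumr_const card_ord -mulr_natr truncn_len_inv//.
by rewrite mulfK// gt_eqF.
Qed.

(** A rejection by the bump block alone is already a rejection, so
    only the lower tail of that block enters. *)
Lemma type2_error_le :
  lr_threshold alpha sigma0 Delta sigma len n <= (1 + kappa2) *
    (m * (1 + a ^+ 2 * (1 + kappa2)) -
     Num.sqrt (8 * (m * (1 + 2 * (a ^+ 2 * (1 + kappa2)))) * - ln alpha)) ->
  (type2_error Z sigma0 Delta sigma len test <= alpha%:E)%E.
Proof.
move=> thr_le; apply: ge_ereal_sup => _ [I bI <-].
have k1 : 0 < 1 + kappa2 by rewrite addr_gt0.
set b := a * Num.sqrt (1 + kappa2).
have b2 : b ^+ 2 = a ^+ 2 * (1 + kappa2).
  by rewrite exprMn sqr_sqrtr// ltW.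
have la : 0 < - ln alpha by rewrite oppr_gt0 ln_lt0// alpha_gt0.
have := noncentral_lower_tail iidZ b
  (card_block_gt0 n_gt0 len_gt0 len_inv len_n bI) la.
rewrite (card_block n_gt0 len_gt0 len_inv len_n bI) -/m opprK lnK ?posrE// b2.
apply: le_trans; apply: le_measure; rewrite ?inE.
- rewrite (_ : mkset _ = ~` [set w | test (hbr_obs (bump_mean Delta I)
    (bump_sd sigma0 sigma I) (fun i => Z i w)) = true]).
    by apply: measurableC; exact: measurable_rejection_event.
  by apply/seteqP; split=> w /=; case: (test _).
- rewrite -[X in measurable X]setCK; apply: measurableC.
  rewrite (_ : ~` _ = [set w | m * (1 + a ^+ 2 * (1 + kappa2)) -
    Num.sqrt (8 * (m * (1 + 2 * (a ^+ 2 * (1 + kappa2)))) * - ln alpha) <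
    \sum_(i in block n I) (Z i w + b) ^+ 2]).
    exact: measurable_superlevel (measurable_sum_sq _ _ _).
  apply/seteqP; split=> w /=; first by move/negP; rewrite -ltNge.
  by move=> h; apply/negP; rewrite -ltNge.
move=> w /= /negbT/(lr_testP n_gt0 len_gt0 len_inv len_n) noj.
move: bI; rewrite bump_intervalsE// => -[j jL jI].
rewrite leNgt; apply/negP => rej; apply: noj; exists j => //.
rewrite jI block_statistic_bump; apply: (le_lt_trans thr_le).
by rewrite ltr_pM2l.
Qed.

End Errors.

(** * The detection boundary *)

Lemma sqrt_le_of_sqr (R : rcfType) (x y : R) :
  0 <= y -> x <= y ^+ 2 -> Num.sqrt x <= y.
Proof. by move=> y0 /ler_wsqrtr; rewrite sqrtr_sqr ger0_norm. Qed.

Lemma sqrt_add_le (R : rcfType) (x y : R) : 0 <= x -> 0 <= y ->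
  Num.sqrt (x + y) <= Num.sqrt x + Num.sqrt y.
Proof.
move=> x0 y0; have sx := sqrtr_ge0 x; have sy := sqrtr_ge0 y.
apply: sqrt_le_of_sqr; first exact: addr_ge0.
rewrite sqrrD !sqr_sqrtr// addrAC lerDl.
by rewrite mulrn_wge0// mulr_ge0.
Qed.

(** The map y |-> sqrt (2 + y^2) is 1-Lipschitz. *)
Lemma sqrt2D_sqr_lipschitz (R : rcfType) (c delta : R) : 0 < c ->
  Num.sqrt (2 + c ^+ 2) <= Num.sqrt (2 + (c * (1 + delta)) ^+ 2) + c * `|delta|.
Proof.
move=> c0; set B := Num.sqrt (2 + (c * (1 + delta)) ^+ 2).
have B2 : B ^+ 2 = 2 + (c * (1 + delta)) ^+ 2.
  by rewrite sqr_sqrtr// addr_ge0// sqr_ge0.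
have B0 : 0 <= B by exact: sqrtr_ge0.
have Bc : c * (1 + delta) <= B.
  rewrite (le_trans (ler_norm _))// -sqrtr_sqr ler_sqrt; first by rewrite lerDr.
  by rewrite addr_ge0// sqr_ge0.
have d0 := normr_ge0 delta.
have r0 : 0 <= B + c * `|delta| by rewrite addr_ge0// mulr_ge0// ltW.
apply: sqrt_le_of_sqr => //; rewrite sqrrD B2 !exprMn real_normK ?num_real//.
have [dn|dn] := leP 0 delta; rewrite ?(ger0_norm dn) ?(ltr0_norm dn).
  have : 0 <= B * (c * delta) by rewrite mulr_ge0// mulr_ge0// ltW.
  have : 0 <= c ^+ 2 * delta by rewrite mulr_ge0 ?sqr_ge0.
  have : 0 <= c ^+ 2 * delta ^+ 2 by rewrite mulr_ge0 ?sqr_ge0.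
  lra.
have : 0 <= (B - c * (1 + delta)) * (c * - delta).
  by rewrite mulr_ge0// ?subr_ge0// mulr_ge0 ?(ltW c0)// oppr_ge0 ltW.
lra.
Qed.

(** Here K = kappa^2 and p^2 = - ln alpha.  Put A = sqrt (1 + 2 a^2) and
    mu = sqrt m.  The difference of the means is
    mu A (s B) + s^2 with B = A / a, so after subtracting 2 mu A sqrt x there
    remains mu A gap + s^2.  Half of mu A gap pays for 2 x, because
    K mu A = s B >= s.  The fluctuation term is at most
    (1 + K) 3 p (mu A + s); its first part is paid by the other half of
    mu A gap and its second part by s^2. *)
Lemma power_inequality (R : rcfType) (m a K x p : R) :
  let s := Num.sqrt m * (a * K) in
  let gap := s * Num.sqrt (2 + a^-1 ^+ 2) - 2 * Num.sqrt x in
  0 < m -> 0 < a -> 0 < K -> 0 <= x -> 0 <= p ->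
  6 * p * (1 + K) <= gap -> 3 * p * (1 + K) <= s -> 4 * x * K <= s * gap ->
  m * (1 + a ^+ 2) + 2 * x + 2 * Num.sqrt (m * (1 + 2 * a ^+ 2) * x) <=
  (1 + K) * (m * (1 + a ^+ 2 * (1 + K)) -
     Num.sqrt (8 * (m * (1 + 2 * (a ^+ 2 * (1 + K)))) * p ^+ 2)).
Proof.
move=> s gap m0 a0 K0 x0 p0 gap_p s_p gap_x.
set mu := Num.sqrt m in s gap gap_p s_p gap_x *.
have mu0 : 0 < mu by rewrite sqrtr_gt0.
have mu2 : mu ^+ 2 = m by rewrite sqr_sqrtr// ltW.
have aa := sqr_ge0 a.
pose A := Num.sqrt (1 + 2 * a ^+ 2).
have A2 : A ^+ 2 = 1 + 2 * a ^+ 2 by rewrite sqr_sqrtr//; lra.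
have A0 : 0 < A by rewrite sqrtr_gt0; lra.
have aA : a <= A.
  by rewrite -[leLHS]gtr0_norm// -sqrtr_sqr ler_sqrt; lra.
have BE : Num.sqrt (2 + a^-1 ^+ 2) = A / a.
  rewrite (_ : 2 + _ = (A / a) ^+ 2); last first.
    by rewrite expr_div_n A2; field; exact: lt0r_neq0.
  by rewrite sqrtr_sqr gtr0_norm// divr_gt0.
set q := Num.sqrt x in gap gap_p gap_x *.
have wE : s * Num.sqrt (2 + a^-1 ^+ 2) = mu * K * A.
  by rewrite BE /s; field; exact: lt0r_neq0.
have -> : Num.sqrt (m * (1 + 2 * a ^+ 2) * x) = mu * A * q.
  by rewrite sqrtrM ?mulr_ge0 ?(ltW m0)// -?A2 ?sqr_ge0// sqrtrM ?(ltW m0)// A2.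
have s0 : 0 < s by rewrite !mulr_gt0.
have gap0 : 0 <= gap by apply: le_trans gap_p; rewrite !mulr_ge0//; lra.
have third : Num.sqrt (8 * (m * (1 + 2 * (a ^+ 2 * (1 + K)))) * p ^+ 2) <=
    3 * mu * (A + a * K) * p.
  have aK : 0 < a * K by rewrite mulr_gt0.
  have r0 : 0 <= 3 * mu * (A + a * K) * p.
    by rewrite mulr_ge0//; apply: ltW; rewrite !mulr_gt0// addr_gt0.
  apply: sqrt_le_of_sqr => //; rewrite !exprMn mu2.
  have -> : 8 * (m * (1 + 2 * (a ^+ 2 * (1 + K)))) * p ^+ 2 =
    (8 * (A ^+ 2 + 2 * a * (a * K))) * (m * p ^+ 2) by rewrite A2; ring.
  have -> : 3 ^+ 2 * m * (A + a * K) ^+ 2 * p ^+ 2 =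
    (9 * (A + a * K) ^+ 2) * (m * p ^+ 2) by ring.
  rewrite ler_wpM2r ?mulr_ge0 ?sqr_ge0 ?(ltW m0)//.
  have : a * (a * K) <= A * (a * K) by rewrite ler_pM2r.
  have := sqr_ge0 (a * K); have := sqr_ge0 A.
  have : 0 < A * (a * K) by rewrite mulr_gt0.
  nra.
have muA0 : 0 < mu * A by rewrite mulr_gt0.
have f1 : mu * A * (6 * p * (1 + K)) <= mu * A * gap by rewrite ler_pM2l.
have f2 : s * (3 * p * (1 + K)) <= s * s by rewrite ler_pM2l.
have f3 : 4 * x <= mu * A * gap.
  rewrite -(ler_pM2r K0) (le_trans gap_x)// [leRHS]mulrAC ler_wpM2r//.
  by rewrite /s -mulrA ler_pM2l// ler_pM2r.
have f4 : (1 + K) * Num.sqrt (8 * (m * (1 + 2 * (a ^+ 2 * (1 + K)))) * p ^+ 2)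
    <= (1 + K) * (3 * mu * (A + a * K) * p).
  by rewrite ler_wpM2l// addr_ge0// ltW.
rewrite mulrBr; apply: le_trans (lerB (lexx _) f4).
have gapE : mu * A * gap = m * K * (1 + 2 * a ^+ 2) - 2 * (mu * A * q).
  by rewrite /gap wE -A2 -mu2; ring.
have ssE : s * s = m * a ^+ 2 * K ^+ 2 by rewrite /s -mu2; ring.
have -> : (1 + K) * (3 * mu * (A + a * K) * p) =
  mu * A * (3 * p * (1 + K)) + s * (3 * p * (1 + K)) by rewrite /s; ring.
have -> : (1 + K) * (m * (1 + a ^+ 2 * (1 + K))) = m * (1 + a ^+ 2) +
  m * K * (1 + 2 * a ^+ 2) + m * a ^+ 2 * K ^+ 2 by ring.
have -> : mu * A * (3 * p * (1 + K)) = (mu * A * (6 * p * (1 + K))) / 2.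
  by field.
move: f1 f2 f3; rewrite gapE ssE; lra.
Qed.

(** Here h = sqrt (- ln |I_n|), K = kappa^2, p^2 = - ln alpha, and q is the
    square root of x = h^2 + p^2.  Replacing B by sqrt (2 + c^2) costs
    s0 c |delta|, at most half of the excess
    eps / sigma0; the other half gives s B >= 2 h + eps h / (2 sigma0).  As q
    exceeds h by at most p, a gap of at least eps h / (4 sigma0) remains, and
    the numerical constants leave it room for the three conclusions. *)
Lemma detection_gap (R : rcfType) (sigma0 c eps delta h p q s K : R) :
  let B := Num.sqrt (2 + (c * (1 + delta)) ^+ 2) in
  let s0 := 2 / Num.sqrt (2 + c ^+ 2) in
  let gap := s * B - 2 * q in
  0 < sigma0 -> 0 < c -> 0 < eps -> 0 < h -> 0 <= p -> 0 < K ->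
  q <= h + p -> p <= h -> q ^+ 2 = h ^+ 2 + p ^+ 2 ->
  s0 * (c * `|delta|) <= eps / (2 * sigma0) ->
  K <= eps -> 32 * sigma0 * K <= s0 * eps ->
  48 * sigma0 * p <= eps * h -> 48 * sigma0 * p <= h ->
  (s0 + eps / sigma0) * h <= s ->
  [/\ 6 * p * (1 + K) <= gap, 3 * p * (1 + K) <= s &
      4 * q ^+ 2 * K <= s * gap].
Proof.
move=> B s0 gap sg0 c0 e0 h0 p0 K0 qhp ph q2 hdelta Ke Ks ph_e ph_h hs.
have B0 : 0 < Num.sqrt (2 + c ^+ 2).
  by rewrite sqrtr_gt0; have := sqr_ge0 c; lra.
have s00 : 0 < s0 by rewrite divr_gt0.
have B1 : 1 <= B.
  rewrite -[leLHS]sqrtr1 ler_sqrt; have := sqr_ge0 (c * (1 + delta)); lra.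
have es0 : 0 < eps / sigma0 by rewrite divr_gt0.
(* s0 times sqrt (2 + c^2) is 2, the factor of sqrt x in the gap. *)
have sB : (2 + eps / (2 * sigma0)) * h <= s * B.
  apply: (@le_trans _ _ ((s0 + eps / sigma0) * h * B)); last first.
    by rewrite ler_wpM2r//; lra.
  rewrite [leRHS]mulrAC ler_wpM2r ?(ltW h0)//.
  have lip := sqrt2D_sqr_lipschitz delta c0.
  have l1 : 2 <= s0 * B + s0 * (c * `|delta|).
    by rewrite -mulrDr -[leLHS](divfK (lt0r_neq0 B0)) ler_pM2l.
  have -> : eps / sigma0 = 2 * (eps / (2 * sigma0)).
    by field; exact: lt0r_neq0.
  have l2 : eps / (2 * sigma0) <= eps / (2 * sigma0) * B.
    by rewrite ler_peMr// divr_ge0 ?mulr_ge0 ?ltW.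
  rewrite [leRHS]mulrDl; move: hdelta l1 l2.
  by move: (s0 * B) (s0 * _) (eps / _) => x y z; lra.
have gap_e : eps * h / (4 * sigma0) <= gap.
  have : 2 * p <= eps * h / (4 * sigma0).
    rewrite ler_pdivlMr ?mulr_gt0//.
    have : 0 <= sigma0 * p by rewrite mulr_ge0// ltW.
    by move: ph_e; lra.
  have : (2 + eps / (2 * sigma0)) * h = 2 * h + 2 * (eps * h / (4 * sigma0)).
    by field; exact: lt0r_neq0.
  by move: sB; rewrite /gap; lra.
have pK : 24 * sigma0 * p * (1 + K) <= eps * h.
  have : 48 * sigma0 * p * K <= h * eps.
    by apply: ler_pM => //; rewrite ?(ltW K0)// mulr_ge0// mulr_ge0// ltW.
  by lra.
have s0h : 0 < s0 * h by rewrite mulr_gt0.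
have seh : eps * h / sigma0 <= s.
  apply: le_trans hs; rewrite mulrDl [eps * h / _]mulrAC; lra.
have pK0 : 0 <= p * (1 + K) by rewrite mulr_ge0// addr_ge0// ltW.
split.
- apply: le_trans gap_e; rewrite ler_pdivlMr ?mulr_gt0//; lra.
- apply: le_trans seh; rewrite ler_pdivlMr//.
  have : 0 <= sigma0 * (p * (1 + K)) by rewrite mulr_ge0// ltW.
  lra.
- apply: (@le_trans _ _ ((s0 * h) * (eps * h / (4 * sigma0)))); last first.
    apply: ler_pM => //; rewrite ?(ltW s0h)//.
      by rewrite ltW// divr_gt0// mulr_gt0.
    by apply: le_trans hs; rewrite ler_pM2r// lerDl ltW.
  rewrite [leRHS]mulrA ler_pdivlMr ?mulr_gt0// q2.
  have : p ^+ 2 <= h ^+ 2 by rewrite lerXn2r// nnegrE// ltW.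
  have : 32 * sigma0 * K * h ^+ 2 <= s0 * eps * h ^+ 2.
    by rewrite ler_wpM2r// sqr_ge0.
  move=> kh php.
  have : (h ^+ 2 + p ^+ 2) * (16 * sigma0 * K) <=
      2 * h ^+ 2 * (16 * sigma0 * K).
    by apply: ler_wpM2r; [rewrite !mulr_ge0 ?ltW|lra].
  lra.
Qed.

(** * Asymptotics *)

Lemma limn_esup_le (R : realType) (u : (\bar R)^nat) (l : \bar R) :
  (\forall k \near \oo, (u k <= l)%E) -> (limn_esup u <= l)%E.
Proof.
move=> ul; apply: le_trans (_ : ereal_sup (u @` [set k | (u k <= l)%E]) <= _)%E.
  by apply: ereal_inf_lbound; exists [set k | (u k <= l)%E].
by apply: ge_ereal_sup => _ [k kl <-].
Qed.

Lemma littleo_seq_le (R : realType) (f g : nat -> R) (e : R) :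
  f =o_\oo g -> 0 < e -> (forall k, 0 < g k) ->
  \forall k \near \oo, `|f k| <= e * g k.
Proof.
move=> /eqoP fg e0 g0; have := fg _ e0; apply: filterS => k.
by rewrite (gtr0_norm (g0 k)).
Qed.

(** Only the type II error is asymptotic: eventually the hypotheses of
    [detection_gap] hold with h = sqrt (- ln |I_n|) and p = sqrt (- ln alpha).
    Since h^2 + p^2 = - ln (alpha |I_n|), its q is the square root
    of the x in the threshold. *)
(* All sequences are indexed by k, with sample size n k; n k = k + 1 is the
   full sequence.  The sample sizes may be a subsequence because 1 / |I_n| and
   n |I_n| integers force 1 / |I_n| to divide n: for prime n it is 1 or n. *)
Theorem theorem5p2 (R : realType) (sigma0 c alpha : R)
  (n : nat -> nat) (len Delta sigma eps : nat -> R)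
  (d : nat -> measure_display) (T : forall k, measurableType (d k))
  (P : forall k, probability (T k) R)
  (Z : forall k, 'I_(n k) -> {RV (P k) >-> R})
  (hZ : forall k, iid_standard_normal (Z k))
  (hsigma0 : 0 < sigma0) (hc : 0 < c) (halpha : 0 < alpha < 1)
  (hn : forall k, (0 < n k)%N) (hn_incr : {homo n : j k / (j < k)%N})
  (hlen : forall k, 0 < len k <= 1)
  (hlen_inv : forall k, (len k)^-1 \is a Num.nat)
  (hlen_n : forall k, (n k)%:R * len k \is a Num.nat)
  (hDelta : forall k, 0 < Delta k) (hsigma : forall k, 0 < sigma k)
  (hlen_decr : nonincreasing_seq len) (hlen0 : len k @[k --> \oo] --> (0 : R))
  (heps : forall k, 0 < eps k)
  (heps_log : eps k * Num.sqrt (- ln (len k)) @[k --> \oo] --> +oo)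
  (hsigma_Delta : exists2 delta : nat -> R, delta =o_\oo eps &
     forall k, sigma k ^+ 2 = c * sigma0 * Delta k * (1 + delta k))
  (hsigma_eps : (fun k => sigma k ^+ 2) =o_\oo eps)
  (hdetect : \forall k \near \oo,
     (Num.sqrt 2 * sigma0 * Num.sqrt (2 / (2 + c ^+ 2)) + eps k)
       * Num.sqrt (- ln (len k))
     <= Num.sqrt ((n k)%:R * len k) * Delta k) :
  let Phi k := @lr_test R alpha sigma0 (Delta k) (sigma k) (len k) (n k) in
  (limn_esup (fun k => type1_error (Z k) sigma0 (Phi k)) <= alpha%:E)%E /\
  (limn_esup (fun k => type2_error (Z k) sigma0 (Delta k) (sigma k) (len k)
                         (Phi k)) <= alpha%:E)%E.
Proof.
move=> Phi; have [alpha0 alpha1] := andP halpha.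
have len0 k : 0 < len k by case/andP: (hlen k).
have len1 k : len k <= 1 by case/andP: (hlen k).
split; apply: limn_esup_le.
  by apply: nearW => k; apply: type1_error_le.
case: hsigma_Delta => delta hdelta sigmaE.
have c2 : 0 < 2 + c ^+ 2 by have := sqr_ge0 c; lra.
pose s0 := 2 / Num.sqrt (2 + c ^+ 2).
have s00 : 0 < s0 by rewrite divr_gt0// sqrtr_gt0.
have s0E : Num.sqrt 2 * sigma0 * Num.sqrt (2 / (2 + c ^+ 2)) = sigma0 * s0.
  rewrite sqrtrM// sqrtrV ?ltW// /s0 !mulrA; congr (_ / _).
  by rewrite mulrAC -expr2 sqr_sqrtr// mulrC.
pose p := Num.sqrt (- ln alpha).
have lna : 0 < - ln alpha by rewrite oppr_gt0 ln_lt0// alpha0.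
have p0 : 0 < p by rewrite sqrtr_gt0.
have p2 : p ^+ 2 = - ln alpha by rewrite sqr_sqrtr// ltW.
pose h k := Num.sqrt (- ln (len k)).
have h_ge M : 0 < M -> \forall k \near \oo, M <= h k.
  move=> M0; have : \forall k \near \oo, `|len k| < expR (- M ^+ 2).
    by apply: (cvgr0_norm_lt _ hlen0); exact: expR_gt0.
  apply: filterS => k; rewrite gtr0_norm// => lenM.
  rewrite -[M]gtr0_norm// -sqrtr_sqr ler_wsqrtr// lerNr.
  by rewrite -[leRHS]expRK ler_ln ?posrE ?expR_gt0// ltW.
have eps_h_ge M : \forall k \near \oo, M <= eps k * h k.
  by move/cvgryPge : heps_log; apply.
have sigma0_s0 : 0 < sigma0 * s0 / 32 by rewrite divr_gt0// mulr_gt0.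
have hd : \forall k \near \oo,
    `|delta k| <= (2 * sigma0 * s0 * c)^-1 * eps k.
  apply: (littleo_seq_le hdelta) => //.
  by rewrite invr_gt0 mulr_gt0// mulr_gt0// mulr_gt0.
have hs1 : \forall k \near \oo, `|sigma k ^+ 2| <= sigma0 ^+ 2 * eps k.
  by apply: (littleo_seq_le hsigma_eps) => //; rewrite exprn_gt0.
have hs2 : \forall k \near \oo, `|sigma k ^+ 2| <= sigma0 * s0 / 32 * eps k.
  exact: (littleo_seq_le hsigma_eps).
have sp : 0 < 48 * sigma0 * p by rewrite !mulr_gt0.
near=> k.
pose K := (sigma k / sigma0) ^+ 2.
pose a := Delta k / (sigma0 * K).
pose m := (n k)%:R * len k.
have K0 : 0 < K by rewrite exprn_gt0// divr_gt0.
have a0 : 0 < a by rewrite divr_gt0// mulr_gt0.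
have m0 : 0 < m by rewrite mulr_gt0// ltr0n; exact: hn.
have h0 : 0 < h k.
  by apply: (lt_le_trans p0); near: k; exact: h_ge.
have h2 : h k ^+ 2 = - ln (len k).
  by rewrite sqr_sqrtr// ltW// -sqrtr_gt0.
have lnE : ln (alpha * len k)^-1 = h k ^+ 2 + p ^+ 2.
  by rewrite lnV ?posrE ?mulr_gt0// lnM ?posrE// h2 p2 opprD addrC.
have aKE : a * K = Delta k / sigma0 by rewrite /a; field; rewrite !lt0r_neq0.
have aV : a^-1 = c * (1 + delta k).
  rewrite /a invf_div /K expr_div_n sigmaE; field.
  by rewrite !lt0r_neq0.
apply: type2_error_le => //.
rewrite lr_thresholdE// lnE -/K -/a -/m -p2.
set q := Num.sqrt (h k ^+ 2 + p ^+ 2).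
have q2 : q ^+ 2 = h k ^+ 2 + p ^+ 2 by rewrite sqr_sqrtr// addr_ge0 ?sqr_ge0.
have qhp : q <= h k + p.
  by rewrite (le_trans (sqrt_add_le _ _)) ?sqr_ge0// !sqrtr_sqr !gtr0_norm.
have [] := @detection_gap R sigma0 c (eps k) (delta k) (h k) p q
   (Num.sqrt m * (a * K)) K hsigma0 hc (heps k) h0 (ltW p0) K0 qhp _ q2.
- by near: k; exact: h_ge.
- have -> : eps k / (2 * sigma0) =
      s0 * (c * ((2 * sigma0 * s0 * c)^-1 * eps k)).
    by field; rewrite !lt0r_neq0.
  by rewrite ler_pM2l// ler_pM2l//; near: k.
- rewrite /K expr_div_n ler_pdivrMr ?exprn_gt0// mulrC.
  by apply: le_trans (ler_norm _) _; near: k.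
- have sig : sigma k ^+ 2 <= sigma0 * s0 / 32 * eps k.
    by apply: le_trans (ler_norm _) _; near: k.
  have -> : 32 * sigma0 * K = 32 / sigma0 * sigma k ^+ 2.
    by rewrite /K; field; exact: lt0r_neq0.
  have -> : s0 * eps k = 32 / sigma0 * (sigma0 * s0 / 32 * eps k).
    by field; exact: lt0r_neq0.
  by rewrite ler_pM2l// divr_gt0.
- by near: k; exact: eps_h_ge.
- by near: k; exact: h_ge.
- rewrite aKE mulrA ler_pdivlMr// mulrAC mulrDl divfK ?gt_eqF//.
  by rewrite [s0 * _]mulrC -s0E /m /h; near: k; exact: hdetect.
rewrite -aV q2 => *; apply: power_inequality => //; last exact: ltW.
by rewrite addr_ge0 ?sqr_ge0.
Unshelve. all: by end_near. Qed.
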